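(* Let $G$ be a finite simple graph of order $n\geq 6$ with minimum degree $\delta(G)$. If $\delta(G)\geq\lceil n/2\rceil+1$, then $G$ has a fort of cardinality less than $\lfloor n/2\rfloor$. Similarly, if $\delta(G)\geq\lfloor n/2\rfloor+1$, then $G$ has a fort of cardinality less than $\lceil n/2\rceil$.
   Context: A fort of a finite simple graph $G=(V,E)$ is a non-empty subset $F\subseteq V$ such that no vertex $u\in V\setminus F$ has exactly one neighbor in $F$. *)

(* Defs.v *)
From mathcomp Require Import all_boot.

Set Implicit Arguments.
Unset Strict Implicit.
Unset Printing Implicit Defensive.

(* A simple graph on [T] is a symmetric irreflexive relation [e : rel T]. *)
Definition neighbors (T : finType) (e : rel T) (v : T) : {set T} :=
  [set w | e v w].

Definition degree (T : finType) (e : rel T) (v : T) : nat :=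
  #|neighbors e v|.

(* The neutral element #|T| bounds every degree from above, so it only matters
   when [T] is empty. *)
Definition min_degree (T : finType) (e : rel T) : nat :=
  \big[minn/#|T|]_(v : T) degree e v.

Definition fort (T : finType) (e : rel T) (F : {set T}) : Prop :=
  F != set0 /\
  ~ (exists2 u : T, u \notin F & #|neighbors e u :&: F| = 1).

(* Main.v *)
Require Import Defs.
From mathcomp Require Import all_boot.
From mathcomp Require Import zify.

(** Let [v] be a vertex of minimum degree and let [F] be the set of its
    non-neighbors, [v] included; it has [n - degree v] elements.  A vertex [u]
    outside [F] with exactly one neighbor in [F] sees only [v] there, so
    N(u) \ v is included in N(v) \ u; as [degree v <= degree u] the two sets
    coincide, hence [u] and [v] are twins and [{u, v}] is a fort.  So every
    nonempty graph has a fort of size at most [maxn 2 (n - degree v)]. *)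

(** Any other vertex sees both twins or neither, so it has two neighbors in the pair or none. *)
Lemma fort_twins (T : finType) (e : rel T) (u v : T) :
  u != v -> (forall w, w != u -> w != v -> e w u = e w v) ->
  fort e [set u; v].
Proof.
move=> uv twin; split; first by apply/set0Pn; exists u; rewrite !inE eqxx.
case=> w; rewrite !inE negb_or => /andP[wu wv].
have ew := twin w wu wv; case ewu: (e w u).
  rewrite (setIidPr _) ?cards2 ?uv //.
  by apply/subsetP=> x; rewrite !inE => /orP[] /eqP->; rewrite -?ew.
suff -> : neighbors e w :&: [set u; v] = set0 by rewrite cards0.
apply/setP=> x; rewrite !inE; apply/negbTE/negP=> /andP[ewx].
by case/orP=> /eqP xE; move: ewx; rewrite xE -?ew ewu.
Qed.

Lemma fort_min_degree_vertex (T : finType) (e : rel T) (v : T) :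
  symmetric e -> irreflexive e -> (forall u, degree e v <= degree e u) ->
  exists2 F : {set T}, fort e F & #|F| <= maxn 2 (#|T| - degree e v).
Proof.
move=> e_sym e_irr v_min; pose F := ~: neighbors e v.
have vF : v \in F by rewrite !inE e_irr.
have [/existsP[u /andP[uF /cards1P[x NuF]]]|nex] :=
  boolP [exists u, (u \notin F) && (#|neighbors e u :&: F| == 1)]; last first.
  exists F; last by rewrite cardsCs setCK leq_maxr.
  split; first by apply/set0Pn; exists v.
  by case=> u uF c1; case/existsP: nex; exists u; rewrite uF c1 eqxx.
have evu : e v u by move: uF; rewrite !inE negbK.
have uv : u != v by apply: contraTneq evu => ->; rewrite e_irr.
have vNuF : v \in neighbors e u :&: F by rewrite inE vF inE e_sym evu.
have NuFv : neighbors e u :&: F = [set v].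
  by move: vNuF; rewrite NuF => /set1P->.
have eqN : neighbors e u :\ v = neighbors e v :\ u.
  apply/eqP; rewrite eqEcard; apply/andP; split.
    apply/subsetP=> w; rewrite !inE => /andP[wv euw]; apply/andP; split.
      by apply: contraTneq euw => ->; rewrite e_irr.
    (* If [w] were not adjacent to [v], it would be a second neighbor of [u] in [F]. *)
    have /setP/(_ w) := NuFv.
    by rewrite !inE euw (negbTE wv) => /negbFE.
  (* As [u] and [v] are adjacent, each deletion removes exactly one element, so [v_min] still
     compares what remains. *)
  move: (v_min u); rewrite /degree (cardsD1 u (neighbors e v)).
  by rewrite (cardsD1 v (neighbors e u)) !inE evu e_sym evu.
exists [set u; v]; last by rewrite cards2 uv leq_maxl.
apply: fort_twins => // w wu wv.
by have /setP/(_ w) := eqN; rewrite !inE wu wv /= !(e_sym w).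
Qed.

Lemma min_degree_le (T : finType) (e : rel T) (v : T) :
  min_degree e <= degree e v.
Proof.
rewrite /min_degree; elim: index_enum (mem_index_enum v) => //= w s IHs.
rewrite inE big_cons geq_min => /orP[/eqP-> | /IHs ->]; first by rewrite leqnn.
exact: orbT.
Qed.

Lemma fort_min_degree (T : finType) (e : rel T) :
  symmetric e -> irreflexive e -> 0 < #|T| ->
  exists2 F : {set T}, fort e F & #|F| <= maxn 2 (#|T| - min_degree e).
Proof.
move=> e_sym e_irr /card_gt0P[v0 _].
have [v _ v_min] := arg_minnP (degree e) (isT : xpredT v0).
have [F fortF leF] := @fort_min_degree_vertex T e v e_sym e_irr
  (fun u => v_min u isT).
(* The size bound can only grow when the degree is replaced by a smaller one. *)
by exists F => //; have := min_degree_le T e v; lia.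
Qed.

Theorem theorem3p3 (T : finType) (e : rel T) (n : nat)
    (e_sym : symmetric e) (e_irr : irreflexive e)
    (card_T : #|T| = n) (n_ge6 : 6 <= n) :
  (uphalf n + 1 <= min_degree e ->
     exists2 F : {set T}, fort e F & #|F| < n./2) /\
  (n./2 + 1 <= min_degree e ->
     exists2 F : {set T}, fort e F & #|F| < uphalf n).
Proof.
have T_gt0 : 0 < #|T| by lia.
have [F fortF leF] := @fort_min_degree T e e_sym e_irr T_gt0.
(* [n - (uphalf n + 1)] is [n./2 - 1] and [n - (n./2 + 1)] is [uphalf n - 1]; [6 <= n] puts 2 below
   both halves. *)
by split=> min_deg; exists F => //; lia.
Qed.
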